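(* $\bigl(\widetilde{\mathcal C}(\mathbb R^n),\widetilde h\bigr)$ is a complete metric space.
   Context: $\mathbb R^n$ carries the Euclidean distance $d$. For nonempty $A,B\subseteq\mathbb R^n$, with $d(x,A)=d(A,x)=\inf\{d(x,a):a\in A\}$, the Hausdorff distance is $h(A,B)=\max\{\sup_{a\in A}d(a,B),\ \sup_{b\in B}d(A,b)\}$. Write $A\sim B$ if there is an isometry $\varphi:\mathbb R^n\to\mathbb R^n$ with $B=\varphi(A)$; this is an equivalence relation and the class of $A$ is $\widetilde A$. The (absolute) shape difference is $\widetilde h(A,B)=\inf\{h(\varphi(A),\psi(B)):\varphi,\psi\text{ isometries of }\mathbb R^n\}$; it depends only on the classes and one sets $\widetilde h(\widetilde A,\widetilde B):=\widetilde h(A,B)$. $\mathcal C(\mathbb R^n)$ is the set of nonempty compact subsets of $\mathbb R^n$, and $\widetilde{\mathcal C}(\mathbb R^n)=\{\widetilde C: C\in\mathcal C(\mathbb R^n)\}$. *)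

(* Defs.v *)
From HB Require Import structures.
From mathcomp Require Import all_boot all_order all_algebra.
From mathcomp Require Import generic_quotient.
From mathcomp Require Import all_classical all_reals all_analysis.

Set Implicit Arguments.
Unset Strict Implicit.
Unset Printing Implicit Defensive.

Import Order.TTheory GRing.Theory Num.Theory.
Import numFieldNormedType.Exports.

Local Open Scope classical_set_scope.
Local Open Scope ring_scope.
Local Open Scope ereal_scope.
Local Open Scope quotient_scope.

Section EuclideanSets.
Context {R : realType} {n : nat}.
Implicit Types (x y : 'rV[R]_n) (A B : set 'rV[R]_n).

Definition edist x y : R :=
  Num.sqrt (\sum_(i < n) (x ord0 i - y ord0 i) ^+ 2)%R.

Definition set_dist x A : \bar R := ereal_inf [set (edist x a)%:E | a in A].

(* The distances are extended reals because the supremum may be infinite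
   when a set is unbounded. *)
Definition hausdorff_dist A B : \bar R :=
  maxe (ereal_sup [set set_dist a B | a in A])
       (ereal_sup [set set_dist b A | b in B]).

(* Surjectivity is not required: it is a consequence, see [isometry_inv]. *)
Definition isometry : set ('rV[R]_n -> 'rV[R]_n) :=
  [set phi | forall x y, edist (phi x) (phi y) = edist x y].

Definition congruent A B : Prop := exists2 phi, isometry phi & B = phi @` A.

Definition shape_diff A B : \bar R :=
  ereal_inf [set hausdorff_dist (phi @` A) (psi @` B)
            | phi in isometry & psi in isometry].

Lemma isometry_id : isometry id.
Proof. by []. Qed.

Lemma isometry_comp phi psi :
  isometry phi -> isometry psi -> isometry (phi \o psi).
Proof. by move=> hphi hpsi x y /=; rewrite hphi hpsi. Qed.

Let sqd x y : R := (\sum_(i < n) (x ord0 i - y ord0 i) ^+ 2)%R.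
Let dot x y : R := (\sum_(i < n) x ord0 i * y ord0 i)%R.

Let sqdE x y : sqd x y = (dot x x + dot y y - dot x y *+ 2)%R.
Proof.
rewrite /sqd /dot -sumrMnl -sumrN -!big_split/=; apply: eq_bigr => i _.
by rewrite sqrrB -!expr2 addrAC.
Qed.

Let sqdB x y (c : 'rV[R]_n) :
  sqd (x - c)%R (y - c)%R = sqd x y.
Proof.
apply: eq_bigr => i _; congr (_ ^+ 2)%R.
by rewrite !mxE opprB addrA subrK.
Qed.

Lemma isometry_inv phi : isometry phi ->
  exists psi, [/\ isometry psi, cancel phi psi & cancel psi phi].
Proof.
move=> hphi.
have sqd_ge0 x y : (0 <= sqd x y)%R.
  by apply: sumr_ge0 => i _; exact: sqr_ge0.
have hsq x y : sqd (phi x) (phi y) = sqd x y.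
  have := hphi x y; rewrite /edist -/(sqd _ _) -/(sqd x y) => h.
  by rewrite -(sqr_sqrtr (sqd_ge0 (phi x) (phi y))) h sqr_sqrtr.
pose f x := (phi x - phi 0)%R.
have f0 : f 0%R = 0%R by rewrite /f subrr.
have fsq x y : sqd (f x) (f y) = sqd x y by rewrite sqdB.
have dot0r z : dot z 0%R = 0%R.
  by rewrite /dot big1// => i _; rewrite mxE mulr0.
have fnorm x : dot (f x) (f x) = dot x x.
  have := fsq x 0%R; rewrite f0 !sqdE !dot0r.
  by rewrite !mul0rn !subr0 !addr0.
have fdot x y : dot (f x) (f y) = dot x y.
  have := fsq x y; rewrite !sqdE !fnorm => /addrI /oppr_inj.
  by move/eqP; rewrite eqrMn2r//= => /eqP.
pose M : 'M[R]_n := \matrix_(i, j) f (delta_mx ord0 i) ord0 j.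
have fMT x : (f x *m M^T)%R = x.
  apply/rowP => i; rewrite mxE.
  transitivity (dot (f x) (f (delta_mx ord0 i))).
    by apply: eq_bigr => j _; rewrite !mxE.
  rewrite fdot /dot (bigD1 i)//= mxE !eqxx mulr1 big1 ?addr0// => j ji.
  by rewrite mxE (negbTE ji) andbF mulr0.
have MMT : (M *m M^T)%R = 1%:M%R.
  apply/row_matrixP => i; rewrite row_mul.
  have -> : row i M = f (delta_mx ord0 i) by apply/rowP => j; rewrite !mxE.
  by rewrite fMT row1.
have MTM := mulmx1C MMT.
have fK x : (x *m M)%R = f x by rewrite -{1}[x]fMT -mulmxA MTM mulmx1.
pose psi y := ((y - phi 0) *m M^T)%R.
have phiK : cancel phi psi by move=> x; exact: fMT.
have psiK : cancel psi phi.
  move=> y; have : f (psi y) = (y - phi 0)%R.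
    by rewrite -fK -mulmxA MTM mulmx1.
  by rewrite /f => /addIr.
exists psi; split => // x y.
by rewrite -hphi !psiK.
Qed.

Lemma congruent_refl A : congruent A A.
Proof. by exists id; [exact: isometry_id|rewrite image_id]. Qed.

Lemma congruent_sym A B : congruent A B -> congruent B A.
Proof.
move=> [phi /isometry_inv[psi [hpsi phiK _]] ->]; exists psi => //.
rewrite image_comp (_ : psi \o phi = id) ?image_id//.
by apply/funext => x /=; rewrite phiK.
Qed.

Lemma congruent_trans A B C :
  congruent A B -> congruent B C -> congruent A C.
Proof.
move=> [phi hphi ->] [psi hpsi ->]; exists (psi \o phi).
  exact: isometry_comp.
by rewrite image_comp.
Qed.

Lemma shape_diff_congruent A A' B B' :
  congruent A A' -> congruent B B' -> shape_diff A B = shape_diff A' B'.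
Proof.
have le A1 A1' B1 B1' : congruent A1 A1' -> congruent B1 B1' ->
    shape_diff A1 B1 <= shape_diff A1' B1'.
  move=> [f hf ->] [g hg ->]; apply: le_ereal_inf.
  move=> _ [phi hphi [psi hpsi <-]].
  exists (phi \o f); first exact: isometry_comp.
  exists (psi \o g); first exact: isometry_comp.
  by rewrite !image_comp.
move=> hA hB; apply/eqP; rewrite eq_le; apply/andP; split; first exact: le.
by apply: le; exact: congruent_sym.
Qed.

End EuclideanSets.

Section ShapeSpace.
Variables (R : realType) (n : nat).

(* Compactness is with respect to the product topology of 'rV[R]_n, which is
   the topology induced by [edist]. *)
Definition compact_sets : set (set 'rV[R]_n) :=
  [set A | compact A /\ A !=set0].

Definition congruentb (A B : compact_sets) : bool :=
  `[< congruent (val A) (val B) >].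

Lemma congruentb_refl : reflexive congruentb.
Proof. by move=> A; apply/asboolP; exact: congruent_refl. Qed.

Lemma congruentb_sym : symmetric congruentb.
Proof. by move=> A B; apply/asboolP/asboolP; exact: congruent_sym. Qed.

Lemma congruentb_trans : transitive congruentb.
Proof.
move=> B A C /asboolP AB /asboolP BC; apply/asboolP.
exact: congruent_trans AB BC.
Qed.

Canonical congruentb_equiv :=
  EquivRel congruentb congruentb_refl congruentb_sym congruentb_trans.

Definition shape_space := {eq_quot congruentb}.

HB.instance Definition _ := Choice.on shape_space.
HB.instance Definition _ := EqQuotient.on shape_space.

Definition shape_dist (X Y : shape_space) : \bar R :=
  shape_diff (val (repr X)) (val (repr Y)).

Lemma shape_distE (A B : compact_sets) :
  shape_dist (\pi_shape_space A) (\pi_shape_space B) =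
  shape_diff (val A) (val B).
Proof.
have piP C : congruent (val (repr (\pi_shape_space C))) (val C).
  by apply/asboolP/(@eqmodP _ congruentb_equiv); rewrite reprK.
by apply: shape_diff_congruent; exact: piP.
Qed.

End ShapeSpace.

(* The equation [(mdist x y)%:E = d x y] also says that [d] is finite. *)
Definition complete_metric_space (R : realType) (T : Type)
    (d : T -> T -> \bar R) : Prop :=
  exists c : Metric.axioms_ R T,
    let M : metricType R := Metric.Pack c in
    (forall x y : M, (mdist x y)%:E = d x y) /\
    (forall F : set_system M, ProperFilter F -> cauchy F ->
       exists x : M, F --> x).

(* Main.v *)
From HB Require Import structures.
From mathcomp Require Import all_boot all_order all_algebra.
From mathcomp Require Import generic_quotient ring lra.
From mathcomp Require Import all_classical all_reals all_analysis.
Require Import Defs.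

(** The argument passes to limits along ultrafilters, which replaces all
extraction of subsequences: in Euclidean space a family that is bounded along
an ultrafilter converges along it ([bounded_ultralim]).

The extended-real shape difference is governed by one symmetric relation:
[hclose e A B] says that each point of one set is within [e] of some point of
the other. Since isometries are invertible, [shape_diff A B < e] gives an
isometry [phi] with [hclose e (phi @` A) B], and such a [phi] gives in turn
[shape_diff A B <= e]. The triangle inequality is then composition of
isometries, and finiteness holds because compact sets are bounded.

Separation. If the shape difference of the compact sets [A] and [B] vanishes,
there are isometries [phi_e] carrying [A] to within [e] of [B], for all
[e > 0]. They are bounded at one point, hence at each point, so they converge
pointwise along an ultrafilter that contains the right neighborhoods of [0].
The limit is an isometry ([isometry_ultralim]); it maps [A] into [B] because
[B] is closed, and onto [B] because approximate preimages in [A] of a point of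
[B] converge too ([congruent_of_hclose]).

Completeness. Let [F] be a Cauchy filter of shapes and [U] an ultrafilter
containing it. The shapes within [1] of a suitable shape [X0] form a set of
[U], and each of them has a representative within [1] of the representative of
[X0]; so these representatives are uniformly bounded. By a form of the
Blaschke selection theorem ([blaschke_ultralim]) they converge along [U], for
the Hausdorff distance, to a compact set. The shape of this set is the limit
of [U], and hence of the coarser Cauchy filter [F]. *)

Set Implicit Arguments.
Unset Strict Implicit.
Unset Printing Implicit Defensive.

Import Order.TTheory GRing.Theory Num.Theory.
Import numFieldNormedType.Exports.

Local Open Scope classical_set_scope.
Local Open Scope ring_scope.
Local Open Scope quotient_scope.

(** * The Euclidean norm inequality *)

Section CauchySchwarz.
Context {R : realType} {n : nat}.
Implicit Types a b : 'I_n -> R.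

(** By Lagrange's identity the difference of the two sides is half of the sum
of the squares [(a i * b j - a j * b i) ^+ 2]. *)
Lemma sum_mul_sqr_le a b :
  (\sum_i a i * b i) ^+ 2 <= (\sum_i a i ^+ 2) * (\sum_i b i ^+ 2).
Proof.
have : 0 <= \sum_i \sum_j (a i * b j - a j * b i) ^+ 2.
  by apply: sumr_ge0 => i _; apply: sumr_ge0 => j _; exact: sqr_ge0.
have -> : \sum_i \sum_j (a i * b j - a j * b i) ^+ 2 =
    \sum_i \sum_j (a i ^+ 2 * b j ^+ 2) + \sum_i \sum_j (b i ^+ 2 * a j ^+ 2)
    - (\sum_i \sum_j (a i * b i) * (a j * b j)) *+ 2.
  rewrite -sumrMnl -sumrN -!big_split; apply: eq_bigr => i _ /=.
  rewrite -sumrMnl -sumrN -!big_split; apply: eq_bigr => j _ /=.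
  ring.
rewrite -!big_distrlr/= -expr2 => h; lra.
Qed.

Lemma sqrt_sum_sqrD a b :
  Num.sqrt (\sum_i (a i + b i) ^+ 2) <=
  Num.sqrt (\sum_i a i ^+ 2) + Num.sqrt (\sum_i b i ^+ 2).
Proof.
have sq_ge0 c : 0 <= \sum_(i < n) c i ^+ 2 :> R.
  by apply: sumr_ge0 => i _; exact: sqr_ge0.
rewrite -(@ler_pXn2r _ 2)// ?nnegrE ?addr_ge0 ?sqrtr_ge0//.
rewrite sqrrD !sqr_sqrtr ?sq_ge0// -sqrtrM ?sq_ge0//.
have -> : \sum_i (a i + b i) ^+ 2 =
    \sum_i a i ^+ 2 + (\sum_i a i * b i) *+ 2 + \sum_i b i ^+ 2.
  by rewrite -sumrMnl -!big_split; apply: eq_bigr => i _ /=; rewrite sqrrD.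
rewrite lerD2r lerD2l lerMn2r/= (le_trans (ler_norm _))//.
by rewrite -sqrtr_sqr ler_sqrt ?sum_mul_sqr_le// mulr_ge0// sq_ge0.
Qed.

End CauchySchwarz.

(** * The Euclidean distance and the topology of row vectors *)

Section EuclideanDistance.
Context {R : realType} {n : nat}.
Implicit Types (x y z : 'rV[R]_n) (A : set 'rV[R]_n).

Lemma edistC x y : edist x y = edist y x.
Proof.
by rewrite /edist; congr Num.sqrt; apply: eq_bigr => i _; rewrite -sqrrN opprB.
Qed.

Lemma edistxx x : edist x x = 0.
Proof.
by rewrite /edist big1 ?sqrtr0// => i _; rewrite subrr expr0n.
Qed.

Lemma coord_le_edist x y i : `|x ord0 i - y ord0 i| <= edist x y.
Proof.
rewrite -sqrtr_sqr ler_sqrt; last by apply: sumr_ge0 => j _; exact: sqr_ge0.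
by rewrite (bigD1 i)//= lerDl; apply: sumr_ge0 => j _; exact: sqr_ge0.
Qed.

Lemma edist_le0 x y : edist x y <= 0 -> x = y.
Proof.
move=> xy0; apply/rowP => i; apply/eqP; rewrite -subr_eq0 -normr_le0.
exact: le_trans (coord_le_edist x y i) xy0.
Qed.

Lemma edist_triangle y x z : edist x z <= edist x y + edist y z.
Proof.
apply: le_trans (sqrt_sum_sqrD _ _); rewrite le_eqVlt; apply/orP; left.
by apply/eqP; congr Num.sqrt; apply: eq_bigr => i _; rewrite addrA subrK.
Qed.

Lemma edist_le_coord x y e :
  0 <= e -> (forall i, `|x ord0 i - y ord0 i| <= e) -> edist x y <= n%:R * e.
Proof.
move=> e0 xye.
have ne0 : 0 <= n%:R * e by rewrite mulr_ge0.
rewrite -(@ler_pXn2r _ 2)// ?nnegrE ?sqrtr_ge0// sqr_sqrtr; last first.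
  by apply: sumr_ge0 => i _; exact: sqr_ge0.
apply: (@le_trans _ _ (\sum_(i < n) e ^+ 2)).
  by apply: ler_sum => i _; rewrite -real_normK ?num_real// lerXn2r ?nnegrE.
rewrite sumr_const card_ord exprMn -[leLHS]mulr_natl ler_wpM2r ?sqr_ge0//.
by rewrite -natrX ler_nat -{1}(expn1 n); case: (n) => // m; rewrite leq_pexp2l.
Qed.

(** Identifies the topology of the row vectors, which is that of the supremum
norm, with the one of [edist]: the two distances are equivalent by
[coord_le_edist] and [edist_le_coord]. *)
Lemma cvg_edistP (F : set_system 'rV[R]_n) (FF : Filter F) x :
  F --> x <-> forall e, 0 < e -> \forall y \near F, edist x y < e.
Proof.
split=> [/cvg_ballP Fx e e0|Fx]; last first.
  apply/cvg_ballP => e e0; apply: filterS (Fx e e0) => y xy; split => // i j.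
  by rewrite ord1 /ball/= (le_lt_trans (coord_le_edist _ _ _)).
(* The radius is divided by [n.+1], since [n] may be zero. *)
have n1 : 0 < n.+1%:R :> R by [].
apply: filterS (Fx (e / n.+1%:R) (divr_gt0 e0 n1)) => y [d0 xy].
apply: (@le_lt_trans _ _ (n%:R * (e / n.+1%:R))).
  by apply: edist_le_coord => [|i]; [exact: ltW|exact/ltW/xy].
by rewrite mulrCA gtr_pMr// ltr_pdivrMr// mul1r ltr_nat.
Qed.

End EuclideanDistance.

(** * Limits along an ultrafilter *)

Section Ultralimits.
Context {T : Type} {U : set_system T} {UU : UltraFilter U}.

Lemma ultra_fmap (X : Type) (f : T -> X) : UltraFilter (f @ U).
Proof.
split=> [|G GF fUG]; first exact: fmap_proper_filter.
rewrite predeqE => A; split=> [GA|]; last exact: fUG.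
have [//|UfA] := in_ultra_setVsetC (f @^-1` A) UU.
have GnA : G (~` A) by exact: fUG.
by have /filter_ex[? []] : G (A `&` ~` A) by exact: filterI.
Qed.

Lemma ultra_nearC (P : T -> Prop) :
  ~ (\forall t \near U, P t) -> \forall t \near U, ~ P t.
Proof. by move=> UP; have [/UP|] := in_ultra_setVsetC [set t | P t] UU. Qed.

Lemma compact_ultralim (X : topologicalType) (A : set X) (f : T -> X) :
  compact A -> (\forall t \near U, A (f t)) -> exists2 x, A x & f @ U --> x.
Proof.
rewrite compact_ultra => cA UA.
by have [x [Ax fx]] := cA _ (ultra_fmap f) UA; exists x.
Qed.

Context {R : realType} {n : nat}.
Implicit Types (x y c : 'rV[R]_n) (f g : T -> 'rV[R]_n).

(** Each coordinate stays in a segment, which is compact, and there are finitely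
many coordinates. *)
Lemma bounded_ultralim f c r :
  (\forall t \near U, edist c (f t) <= r) -> exists x, f @ U --> x.
Proof.
move=> Ur.
have fi i : exists x : R, f t ord0 i @[t --> U] --> x.
  have := @segment_compact R (c ord0 i - r) (c ord0 i + r).
  move=> /compact_ultralim => /(_ (fun t => f t ord0 i)) [|x _ fx].
    apply: filterS Ur => t ctr /=; rewrite in_itv/= -ler_distlC distrC.
    by rewrite (le_trans _ ctr)// distrC coord_le_edist.
  by exists x.
have [x fx] := choice fi.
exists (\row_i x i); apply/cvg_ballP => e e0.
have : \forall t \near U, forall i, ball (x i) e (f t ord0 i).
  apply: filter_forall => i.
  by move/cvg_ballP : (fx i); exact.
apply: filterS => t ft; split=> // i j; rewrite ord1 mxE; exact: ft.
Qed.

Lemma ultralim_near f x e : f @ U --> x -> 0 < e ->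
  \forall t \near U, edist x (f t) < e.
Proof. by move=> /cvg_edistP; exact. Qed.

End Ultralimits.

(** * Compactness in terms of the Euclidean distance *)

Section Compactness.
Context {R : realType} {n : nat}.
Implicit Types (x y c : 'rV[R]_n) (A B L : set 'rV[R]_n).

(** The condition [edist c x <= r] holds for all large [r], locally uniformly
in [x]; compactness makes this uniform on [A]. *)
Lemma compact_edist_bounded A c :
  compact A -> exists r, forall a, A a -> edist c a <= r.
Proof.
move=> /compact_near_coveringP/(_ R +oo (fun r x => edist c x <= r)).
have near_le x : A x -> \forall y \near x & r \near +oo, edist c y <= r.
  move=> _; exists ([set y | edist x y < 1], [set r | edist c x + 1 <= r]).
    split; last by apply: nbhs_pinfty_ge; rewrite num_real.
    exact: ((@cvg_edistP _ _ _ (nbhs_filter x) x).1 cvg_id).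
  move=> [y r] [/= xy1 cxr]; apply: le_trans (edist_triangle x _ _) _.
  by apply: le_trans cxr; rewrite lerD2l ltW.
move=> /(_ _ near_le) /filter_ex[r Ar]; exists r => a Aa; exact: Ar.
Qed.

Lemma edist_closed_bounded_compact A c r :
  (forall a, A a -> edist c a <= r) ->
  (forall x, (forall e, 0 < e -> exists2 a, A a & edist x a < e) -> A x) ->
  compact A.
Proof.
move=> bA clA; rewrite compact_ultra => U UU UA.
have [|x Ux] := @bounded_ultralim _ U UU R n id c r.
  exact: filterS UA.
exists x; split => //; apply: clA => e e0.
have /filter_ex[a [Aa xa]] : U (A `&` [set a | edist x a < e]).
  by apply: filterI UA _; exact: (ultralim_near Ux e0).
by exists a.
Qed.

(** Points of [A] chosen within [e] of [x] tend to [x] as [e] tends to [0], and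
along an ultrafilter they also tend to a point of [A]. *)
Lemma compact_edist_closed A x : compact A ->
  (forall e, 0 < e -> exists2 a, A a & edist x a < e) -> A x.
Proof.
move=> cA xA.
have xA' (e : R) : exists a, 0 < e -> A a /\ edist x a < e.
  by have [/xA[a Aa xa]|_] := ltP 0 e; [exists a|exists x].
have [f fP] := choice xA'.
have [U [UU sU]] := ultraFilterLemma (@at_right_proper_filter R 0).
have Ugt0 : \forall e \near U, 0 < e by apply: sU; exact: nbhs_right_gt.
have [y Ay fy] : exists2 y, A y & f @ U --> y.
  apply: compact_ultralim => //; apply: filterS Ugt0 => e /fP[]//.
have fx : f @ U --> x.
  apply/cvg_edistP => d d0.
  have Ud : \forall e \near U, e < d by apply: sU; exact: nbhs_right_lt.
  by apply: filterS2 Ugt0 Ud => e /fP[_ xe] /(lt_trans xe).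
suff -> : x = y by [].
apply: edist_le0; apply/ler_addgt0Pr => e e0; rewrite add0r [e]splitr.
have e2 : 0 < e / 2 by rewrite divr_gt0.
have /filter_ex[t [xt yt]] : \forall t \near U,
    edist x (f t) < e / 2 /\ edist y (f t) < e / 2.
  by apply: filterI; exact: ultralim_near.
apply: le_trans (edist_triangle (f t) _ _) _.
by rewrite lerD// ltW// edistC.
Qed.

End Compactness.

(** * Hausdorff closeness *)

Section Closeness.
Context {R : realType} {n : nat}.
Implicit Types (x y c : 'rV[R]_n) (A B C L : set 'rV[R]_n).

(** Up to the attainment of infima and suprema, this is [hausdorff_dist A B <= e];
see [hausdorff_dist_le] and [hausdorff_dist_lt]. *)
Definition hclose (e : R) A B :=
  (forall a, A a -> exists2 b, B b & edist a b <= e) /\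
  (forall b, B b -> exists2 a, A a & edist a b <= e).

Lemma hclose_refl A : hclose 0 A A.
Proof. by split=> a Aa; exists a => //; rewrite edistxx. Qed.

Lemma hclose_sym e A B : hclose e A B -> hclose e B A.
Proof.
by move=> [AB BA]; split=> [b /BA|a /AB] [x ? ?]; exists x => //; rewrite edistC.
Qed.

Lemma hclose_trans d e A B C :
  hclose d A B -> hclose e B C -> hclose (d + e) A C.
Proof.
move=> [AB BA] [BC CB]; split.
  move=> a /AB[b /BC[c Cc bc] ab]; exists c => //.
  by rewrite (le_trans (edist_triangle b _ _))// lerD.
move=> c /CB[b /BA[a Aa ab] bc]; exists a => //.
by rewrite (le_trans (edist_triangle b _ _))// lerD.
Qed.

Lemma hclose_image e phi A B :
  isometry phi -> hclose e A B -> hclose e (phi @` A) (phi @` B).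
Proof.
move=> phiI [AB BA]; split.
  by move=> _ [a /AB[b Bb ab] <-]; exists (phi b); [exists b|rewrite phiI].
by move=> _ [b /BA[a Aa ab] <-]; exists (phi a); [exists a|rewrite phiI].
Qed.

Lemma hclose_bounded c r A B :
  A !=set0 -> B !=set0 ->
  (forall a, A a -> edist c a <= r) -> (forall b, B b -> edist c b <= r) ->
  hclose (r + r) A B.
Proof.
move=> [a0 Aa0] [b0 Bb0] Ar Br; split.
  move=> a Aa; exists b0 => //; rewrite (le_trans (edist_triangle c _ _))//.
  by rewrite lerD ?Br// edistC Ar.
move=> b Bb; exists a0 => //; rewrite (le_trans (edist_triangle c _ _))//.
by rewrite lerD ?Br// edistC Ar.
Qed.

Lemma hausdorff_distC A B : hausdorff_dist A B = hausdorff_dist B A.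
Proof. by rewrite /hausdorff_dist maxC. Qed.

Lemma hausdorff_dist_le e A B : hclose e A B -> (hausdorff_dist A B <= e%:E)%E.
Proof.
have half C D : (forall a, C a -> exists2 b, D b & edist a b <= e) ->
    (ereal_sup [set set_dist a D | a in C] <= e%:E)%E.
  move=> CD; apply: ge_ereal_sup => _ [a /CD[b Db ab] <-].
  apply: (@le_trans _ _ (edist a b)%:E); last by rewrite lee_fin.
  by apply: ereal_inf_lbound; exists b.
move=> eAB; rewrite /hausdorff_dist ge_max; apply/andP; split; apply: half.
  by case: eAB.
by case: (hclose_sym eAB).
Qed.

Lemma hausdorff_dist_lt e A B : (hausdorff_dist A B < e%:E)%E -> hclose e A B.
Proof.
have half C D : (ereal_sup [set set_dist a D | a in C] < e%:E)%E ->
    forall a, C a -> exists2 b, D b & edist a b <= e.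
  move=> CD a Ca; have : (set_dist a D < e%:E)%E.
    by apply: le_lt_trans CD; apply: ereal_sup_ubound; exists a.
  by move=> /ereal_inf_lt[_ [b Db <-]]; rewrite lte_fin => /ltW; exists b.
rewrite /hausdorff_dist gt_max => /andP[AB BA]; split; first exact: half.
by move=> b /(half _ _ BA)[a Aa]; rewrite edistC; exists a.
Qed.

Lemma hausdorff_dist_ge0 A B : A !=set0 -> (0 <= hausdorff_dist A B)%E.
Proof.
move=> [a Aa]; rewrite /hausdorff_dist le_max; apply/orP; left.
apply: (@le_trans _ _ (set_dist a B)).
  by apply: le_ereal_inf_tmp => _ [b _ <-]; rewrite lee_fin sqrtr_ge0.
by apply: ereal_sup_ubound; exists a.
Qed.

End Closeness.

(** * The shape difference of sets *)

Section ShapeDifference.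
Context {R : realType} {n : nat}.
Implicit Types (A B C : set 'rV[R]_n).

Lemma shape_diffC A B : shape_diff A B = shape_diff B A.
Proof.
rewrite /shape_diff; congr ereal_inf; apply/seteqP.
by split=> _ [phi phiI [psi psiI <-]]; exists psi => //; exists phi => //;
  rewrite hausdorff_distC.
Qed.

Lemma shape_diff_ge0 A B : A !=set0 -> (0 <= shape_diff A B)%E.
Proof.
move=> [a Aa]; apply: le_ereal_inf_tmp => _ [phi _ [psi _ <-]].
by apply: hausdorff_dist_ge0; exists (phi a), a.
Qed.

Lemma shape_diff_le e phi A B :
  isometry phi -> hclose e (phi @` A) B -> (shape_diff A B <= e%:E)%E.
Proof.
move=> phiI AB; apply: le_trans (hausdorff_dist_le AB).
apply: ereal_inf_lbound; exists phi => //; exists id; first exact: isometry_id.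
by rewrite image_id.
Qed.

(** Only one isometry is needed: the one applied to [B] can be undone on both
sides. *)
Lemma shape_diff_lt e A B : (shape_diff A B < e%:E)%E ->
  exists2 phi, isometry phi & hclose e (phi @` A) B.
Proof.
move=> /ereal_inf_lt[_ [phi phiI [psi psiI <-]]] /hausdorff_dist_lt AB.
have [chi [chiI psiK _]] := isometry_inv psiI.
exists (chi \o phi); first exact: isometry_comp.
have -> : B = chi @` (psi @` B).
  rewrite image_comp (_ : chi \o psi = id) ?image_id//.
  by apply/funext => x /=; rewrite psiK.
by rewrite -image_comp; exact: hclose_image.
Qed.

Lemma shape_diff_fin_num A B : compact A -> A !=set0 -> compact B -> B !=set0 ->
  shape_diff A B \is a fin_num.
Proof.
move=> cA A0 cB B0.
have [r Ar] := compact_edist_bounded 0 cA.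
have [s Bs] := compact_edist_bounded 0 cB.
have AB : hclose (Num.max r s + Num.max r s) A B.
  by apply: (@hclose_bounded _ _ 0) => // x => [/Ar|/Bs]; rewrite le_max => ->;
    rewrite ?orbT.
rewrite fin_numElt (lt_le_trans _ (shape_diff_ge0 _ A0)) ?ltNyr//=.
apply: le_lt_trans (ltry (Num.max r s + Num.max r s)).
by apply: (shape_diff_le isometry_id); rewrite image_id.
Qed.

Lemma shape_diff_refl A : A !=set0 -> shape_diff A A = 0%E.
Proof.
move=> A0; apply/eqP; rewrite eq_le shape_diff_ge0// andbT.
by apply: (shape_diff_le isometry_id); rewrite image_id; exact: hclose_refl.
Qed.

Lemma shape_diff_triangle B A C :
  A !=set0 -> B !=set0 ->
  (shape_diff A C <= shape_diff A B + shape_diff B C)%E.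
Proof.
move=> A0 B0; have := shape_diff_ge0 B A0; have := shape_diff_ge0 C B0.
case E1: (shape_diff A B) => [d| |]//; case E2: (shape_diff B C) => [e| |]//.
- move=> _ _; apply/lee_addgt0Pr => r r0.
  have [|phi phiI AB] := @shape_diff_lt (d + r / 2) A B.
    by rewrite E1 lte_fin ltrDl divr_gt0.
  have [|psi psiI BC] := @shape_diff_lt (e + r / 2) B C.
    by rewrite E2 lte_fin ltrDl divr_gt0.
  have -> : (d%:E + e%:E + r%:E)%E = ((d + r / 2) + (e + r / 2))%:E.
    by rewrite -!EFinD; congr EFin; field.
  apply: (@shape_diff_le _ (psi \o phi)); first exact: isometry_comp.
  by rewrite -image_comp; apply: hclose_trans BC; exact: hclose_image.
- by rewrite addey ?leey.
- by rewrite addye ?leey.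
- by rewrite addye ?leey.
Qed.

End ShapeDifference.

(** * Limits of isometries and of bounded sets *)

Section Limits.
Context {T : Type} {U : set_system T} {UU : UltraFilter U}.
Context {R : realType} {n : nat}.
Implicit Types (x y c : 'rV[R]_n) (L : set 'rV[R]_n).

(** Boundedness at the single point [a] propagates to every point [x], since an
isometry preserves the distance from [a] to [x]. *)
Lemma isometry_ultralim (phi : T -> 'rV[R]_n -> 'rV[R]_n) a c r :
  (\forall t \near U, isometry (phi t)) ->
  (\forall t \near U, edist c (phi t a) <= r) ->
  exists2 psi, isometry psi & forall x, phi t x @[t --> U] --> psi x.
Proof.
move=> phiI phia.
have phix x : exists y, phi t x @[t --> U] --> y.
  apply: (@bounded_ultralim _ _ _ _ _ _ c (r + edist a x)).
  apply: filterS2 phiI phia => t phiI phia.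
  by rewrite (le_trans (edist_triangle (phi t a) _ _))// lerD// phiI.
have [psi psiP] := choice phix.
exists psi => // x y.
have small e : 0 < e -> exists t, [/\ isometry (phi t),
    edist (psi x) (phi t x) < e / 2 & edist (psi y) (phi t y) < e / 2].
  move=> e0; have e2 : 0 < e / 2 by rewrite divr_gt0.
  have [t [tI [tx ty]]] := filter_ex (filterI phiI
    (filterI (ultralim_near (psiP x) e2) (ultralim_near (psiP y) e2))).
  by exists t.
apply/eqP; rewrite eq_le; apply/andP; split; apply/ler_addgt0Pr => e /small[t].
  move=> [tI tx ty]; rewrite -(tI x y).
  have := edist_triangle (phi t x) (psi x) (psi y).
  have := edist_triangle (phi t y) (phi t x) (psi y).
  rewrite (edistC (phi t y) (psi y)); lra.
move=> [tI tx ty]; rewrite -(tI x y).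
have := edist_triangle (psi x) (phi t x) (phi t y).
have := edist_triangle (psi y) (psi x) (phi t y).
rewrite (edistC (phi t x) (psi x)); lra.
Qed.

(** Blaschke selection along an ultrafilter. The limit is the set of points that
are approximated, up to any [e > 0], by points of [A t] for [U]-almost all [t];
this set is closed and bounded by construction. If closeness failed for some
[e], it would fail for [U]-almost all [t], as [U] is an ultrafilter; the
witnesses of failure would then converge along [U] to a point of [L], and
closeness holds near that point. *)
Lemma blaschke_ultralim (A : T -> set 'rV[R]_n) c r :
  (\forall t \near U, forall a, A t a -> edist c a <= r) ->
  exists2 L, compact L & forall e, 0 < e -> \forall t \near U, hclose e (A t) L.
Proof.
move=> bA.
pose L : set 'rV[R]_n := [set x | forall e, 0 < e ->
  \forall t \near U, exists2 a, A t a & edist x a < e].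
have clL x : (forall e, 0 < e -> exists2 y, L y & edist x y < e) -> L x.
  move=> xL e e0; have e2 : 0 < e / 2 by rewrite divr_gt0.
  have [y Ly xy] := xL _ e2.
  apply: filterS (Ly _ e2) => t [a Aa ya]; exists a => //.
  by rewrite (le_lt_trans (edist_triangle y _ _))// [e]splitr ltrD.
have bL x : L x -> edist c x <= r + 1.
  move=> /(_ 1 ltr01) Lx.
  have [t [/= ctr [a Aa xa]]] := filter_ex (filterI bA Lx).
  rewrite (le_trans (edist_triangle a _ _))// lerD ?ctr//.
  by rewrite edistC ltW.
exists L; first exact: edist_closed_bounded_compact bL clL.
move=> e e0; have e2 : 0 < e / 2 by rewrite divr_gt0.
suff [AL LA] : (\forall t \near U, forall a, A t a -> exists2 x, L x & edist a x <= e)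
    /\ (\forall t \near U, forall x, L x -> exists2 a, A t a & edist a x <= e).
  by apply: filterS2 AL LA => t.
(* [f] picks, wherever closeness fails, a point at distance more than [e] from
   the other set: first a point of [A t], then a point of [L]. *)
split; apply: contrapT => /ultra_nearC bad.
  have /choice[f fP] t : exists a,
      ~ (forall a, A t a -> exists2 x, L x & edist a x <= e) ->
      A t a /\ forall x, L x -> e < edist a x.
    have [tP|/existsNP[a /not_implyP[Aa La]]] :=
      pselect (forall a, A t a -> exists2 x, L x & edist a x <= e).
      by exists c.
    exists a => _; split => // x Lx; rewrite ltNge; apply/negP => ax.
    by apply: La; exists x.
  have [x fx] : exists x, f @ U --> x.
    apply: (@bounded_ultralim _ _ _ _ _ _ c r).
    by apply: filterS2 bA bad => t ctr /fP[+ _]; exact: ctr.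
  have Lx : L x.
    move=> d d0; apply: filterS2 bad (ultralim_near fx d0) => t /fP[Aft _] xft.
    by exists (f t).
  have [t [/fP[_ /(_ _ Lx)]]] := filter_ex (filterI bad (ultralim_near fx e0)).
  by rewrite edistC => /lt_trans h /h; rewrite ltxx.
have /choice[f fP] t : exists x,
    ~ (forall x, L x -> exists2 a, A t a & edist a x <= e) ->
    L x /\ forall a, A t a -> e < edist a x.
  have [tP|/existsNP[x /not_implyP[Lx Ax]]] :=
    pselect (forall x, L x -> exists2 a, A t a & edist a x <= e).
    by exists c.
  exists x => _; split => // a Aa; rewrite ltNge; apply/negP => ax.
  by apply: Ax; exists a.
have [x Lx fx] : exists2 x, L x & f @ U --> x.
  apply: compact_ultralim; first exact: edist_closed_bounded_compact bL clL.
  by apply: filterS bad => t /fP[].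
have [t [/fP[_ eA] [[a Aa xa] xf]]] :=
  filter_ex (filterI bad (filterI (Lx _ e2) (ultralim_near fx e2))).
have := eA _ Aa; apply/negP; rewrite -leNgt.
by rewrite (le_trans (edist_triangle x _ _))// [e]splitr lerD// ltW// edistC.
Qed.

End Limits.

(** * Separation *)

Section Separation.
Context {R : realType} {n : nat}.
Implicit Types (A B : set 'rV[R]_n).

(** The isometry sought is a limit of the isometries [phi e] as [e] tends to [0],
along an ultrafilter finer than the right neighborhoods of [0]. *)
Lemma congruent_of_hclose A B : compact A -> compact B -> B !=set0 ->
  (forall e : R, 0 < e -> exists2 phi, isometry phi & hclose e (phi @` A) B) ->
  congruent A B.
Proof.
move=> cA cB [b0 Bb0] AB.
have /choice[phi phiP] (e : R) : exists phi, 0 < e ->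
    isometry phi /\ hclose e (phi @` A) B.
  by have [/AB[phi ? ?]|_] := ltP 0 e; [exists phi|exists id].
have [U [UU sU]] := ultraFilterLemma (@at_right_proper_filter R 0).
have U0 : \forall e \near U, isometry (phi e) /\ hclose e (phi e @` A) B.
  by apply: filterS (phiP) _; apply: sU; exact: nbhs_right_gt.
have Ud d : 0 < d -> \forall e \near U, e < d.
  by move=> d0; apply: sU; exact: nbhs_right_lt.
have [[a0 Aa0]|A0] := pselect (A !=set0); last first.
  by have [e [_ [_ /(_ _ Bb0)[_ [a Aa _] _]]]] := filter_ex U0; case: A0; exists a.
have [r Br] := compact_edist_bounded 0 cB.
have [psi psiI phipsi] : exists2 psi, isometry psi &
    forall x, phi e x @[e --> U] --> psi x.
  apply: (@isometry_ultralim _ _ _ _ _ _ a0 0 (r + 1)).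
    by apply: filterS U0 => e [].
  apply: filterS2 U0 (Ud _ ltr01) => e [_ [/(_ (phi e a0)) PB _]] e1.
  have [|b Bb ab] := PB; first by exists a0.
  rewrite (le_trans (edist_triangle b _ _))// lerD ?Br// edistC.
  by rewrite (le_trans ab)// ltW.
exists psi => //; apply/seteqP; split=> [b Bb|_ [a Aa <-]]; last first.
  apply: compact_edist_closed => // d d0; have d2 : 0 < d / 2 by rewrite divr_gt0.
  have [e [[_ [/(_ (phi e a)) PB _]] [ed pa]]] := filter_ex (filterI U0
    (filterI (Ud _ d2) (ultralim_near (phipsi a) d2))).
  have [|b Bb ab] := PB; first by exists a.
  exists b => //; rewrite (le_lt_trans (edist_triangle (phi e a) _ _))//.
  by rewrite [d]splitr ltrD// (le_lt_trans ab).
(* Surjectivity: [g e] is a point of [A] that [phi e] maps within [e] of [b];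
   the limit of [g e] is mapped to [b]. *)
have /choice[g gP] e : exists a, hclose e (phi e @` A) B ->
    A a /\ edist (phi e a) b <= e.
  have [[_ /(_ _ Bb)[_ [a Aa <-] ab]]|nAB] := pselect (hclose e (phi e @` A) B).
    by exists a.
  by exists a0 => /nAB.
have [a Aa ga] : exists2 a, A a & g @ U --> a.
  by apply: compact_ultralim => //; apply: filterS U0 => e [_ /gP[]].
exists a => //; apply: edist_le0; apply/ler_addgt0Pr => d d0; rewrite add0r.
have d3 : 0 < d / 3 by rewrite divr_gt0.
have [e [[phiI /gP[_ gb]] [ed [age pae]]]] := filter_ex (filterI U0 (filterI
  (Ud _ d3) (filterI (ultralim_near ga d3) (ultralim_near (phipsi a) d3)))).
have := edist_triangle (phi e a) (psi a) b.
have := edist_triangle (phi e (g e)) (phi e a) b.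
rewrite phiI /= in age pae ed gb *; lra.
Qed.

Lemma shape_diff0_congruent A B :
  compact A -> compact B -> B !=set0 -> shape_diff A B = 0%E -> congruent A B.
Proof.
move=> cA cB B0 AB; apply: congruent_of_hclose => // e e0.
by apply: shape_diff_lt; rewrite AB lte_fin.
Qed.

End Separation.

(** * The metric space of shapes *)

Section ShapeMetric.
Context {R : realType} {n : nat}.
Implicit Types (X Y Z : shape_space R n).

Definition shape_metric X Y : R := fine (shape_dist X Y).

Lemma repr_compact X : compact (val (repr X)).
Proof. by have /set_mem[] := valP (repr X). Qed.

Lemma repr_neq0 X : val (repr X) !=set0.
Proof. by have /set_mem[] := valP (repr X). Qed.

Lemma shape_metricE X Y : (shape_metric X Y)%:E = shape_dist X Y.
Proof.
by rewrite fineK// shape_diff_fin_num//; do ?[exact: repr_compact|exact: repr_neq0].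
Qed.

Lemma shape_metricxx X : shape_metric X X = 0.
Proof. by rewrite /shape_metric /shape_dist shape_diff_refl//; exact: repr_neq0. Qed.

Lemma shape_metric_eq0 X Y : shape_metric X Y = 0 -> X = Y.
Proof.
move=> XY; rewrite -[X]reprK -[Y]reprK; apply/eqmodP/asboolP.
apply: shape_diff0_congruent; do ?[exact: repr_compact|exact: repr_neq0].
by rewrite -[LHS]shape_metricE XY.
Qed.

Lemma shape_metricC X Y : shape_metric X Y = shape_metric Y X.
Proof. by rewrite /shape_metric /shape_dist shape_diffC. Qed.

Lemma shape_metric_triangle Y X Z :
  shape_metric X Z <= shape_metric X Y + shape_metric Y Z.
Proof.
rewrite -lee_fin EFinD !shape_metricE.
by apply: shape_diff_triangle; exact: repr_neq0.
Qed.

HB.instance Definition _ := isMetric.Build R (shape_space R n)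
  shape_metricxx shape_metric_eq0 shape_metricC shape_metric_triangle.

Lemma shape_ballE X (e : R) : ball X e = [set Y | shape_metric X Y < e].
Proof. exact: ballEmdist. Qed.

(** The representatives have to be moved before a limit can be taken, because a
shape says nothing about the position of its sets; [phi X] moves the one of [X]
next to that of [X0]. *)
Lemma shape_space_complete (F : set_system (shape_space R n)) :
  ProperFilter F -> cauchy F -> exists X, F --> X.
Proof.
move=> PF /cauchyP Fc.
have [X0 FX0] := Fc 1 ltr01.
have [U [UU sFU]] := ultraFilterLemma PF.
have /choice[phi phiP] X : exists phi, isometry phi /\ (shape_metric X0 X < 1 ->
    hclose 1 (phi @` val (repr X)) (val (repr X0))).
  have [XX0|_] := ltP (shape_metric X0 X) 1; last by exists id.
  have [|phi phiI clo] := @shape_diff_lt _ _ 1 (val (repr X)) (val (repr X0)).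
    by rewrite shape_diffC -[X in (X < _)%E]shape_metricE lte_fin.
  by exists phi.
pose A X := phi X @` val (repr X).
have [r X0r] := compact_edist_bounded 0 (@repr_compact X0).
have [L cL AL] : exists2 L, compact L &
    forall e, 0 < e -> \forall X \near U, hclose e (A X) L.
  apply: (@blaschke_ultralim _ _ _ _ _ _ 0 (r + 1)).
  apply: filterS (sFU _ FX0) => X; rewrite shape_ballE/= => X0X a Aa.
  have [_ /(_ X0X)[/(_ _ Aa)[x Xx ax] _]] := phiP X.
  by rewrite (le_trans (edist_triangle x _ _))// lerD ?X0r// edistC.
have L0 : L !=set0.
  have [X [+ _]] := filter_ex (AL _ ltr01).
  have [a Xa] := repr_neq0 X.
  by move=> /(_ (phi X a))[|l Ll _]; [exists a|exists l].
pose Lc : @compact_sets R n := exist _ L (mem_set (conj cL L0)).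
pose l : shape_space R n := \pi_(shape_space R n) Lc; exists l.
apply/cvg_ballP => e e0; have e3 : 0 < e / 3 by rewrite divr_gt0.
(* [U] contains shapes [X] near [l], and [F] contains a small ball; the two
   meet since [U] contains [F]. *)
have [Y FY] := Fc _ e3.
have [X [XL YX]] := filter_ex (filterI (AL _ e3) (sFU _ FY)).
have {}XL : shape_metric X l <= e / 3.
  rewrite -lee_fin shape_metricE -{1}[X]reprK shape_distE.
  by apply: shape_diff_le XL; exact: (phiP X).1.
apply: filterS FY => Z; move: YX; rewrite !shape_ballE/= => YX YZ.
have := shape_metric_triangle X l Z.
have := shape_metric_triangle Y X Z.
rewrite (shape_metricC X Y) (shape_metricC l X); lra.
Qed.

End ShapeMetric.

Theorem theorem2p2 (R : realType) (n : nat) :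
  complete_metric_space (@shape_dist R n).
Proof.
exists (Metric.class (shape_space R n)); split.
  exact: shape_metricE.
exact: shape_space_complete.
Qed.
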